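(* Let $R$ be a commutative ring with identity $1\neq 0$ such that $|Z(R)|\geq 4$. If the extended zero-divisor graph $\overline{\Gamma}(R)$ is complemented, then $|\mathrm{Nil}(R)|\leq 2$.
   Context: $Z(R)$ is the set of zero-divisors of $R$ (including $0$), $Z(R)^*=Z(R)\setminus\{0\}$, and $\mathrm{Nil}(R)$ is the set of nilpotent elements of $R$ (including $0$). The extended zero-divisor graph $\overline{\Gamma}(R)$ is the simple graph with vertex set $Z(R)^*$ in which two distinct vertices $x,y$ are adjacent if and only if there exist positive integers $n,m$ with $x^ny^m=0$, $x^n\neq 0$ and $y^m\neq 0$. In a simple graph $G$, two vertices $u,v$ are orthogonal, written $u\perp v$, if they are adjacent and no vertex is adjacent to both of them (the edge $u-v$ is not part of a triangle). $G$ is complemented if for every vertex $v$ there is a vertex $u$ with $v\perp u$. *)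

(* Defs.v *)
From HB Require Import structures.
From mathcomp Require Import all_boot all_order all_algebra.
From mathcomp Require Import boolp classical_sets functions cardinality.

Set Implicit Arguments.
Unset Strict Implicit.
Unset Printing Implicit Defensive.

Import GRing.Theory.
Local Open Scope classical_set_scope.
Local Open Scope ring_scope.

(* The vertex set is not assumed to be finite. *)
Record sgraph (T : Type) := SGraph {
  vertices : set T;
  adjacent : T -> T -> Prop;
  adjacent_vertices : forall x y, adjacent x y -> vertices x /\ vertices y;
  adjacent_sym : forall x y, adjacent x y -> adjacent y x;
  adjacent_irrefl : forall x, ~ adjacent x x
}.

Definition orthogonal (T : Type) (G : sgraph T) (u v : T) : Prop :=
  adjacent G u v /\
  ~ (exists2 w, vertices G w & adjacent G w u /\ adjacent G w v).

Definition complemented (T : Type) (G : sgraph T) : Prop :=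
  forall v, vertices G v -> exists2 u, vertices G u & orthogonal G v u.

Definition zero_divisors (R : comNzRingType) : set R :=
  [set x | exists2 y : R, y != 0 & x * y = 0].

Arguments zero_divisors R : clear implicits.

Definition zero_divisors_star (R : comNzRingType) : set R :=
  zero_divisors R `\ 0.
Arguments zero_divisors_star R : clear implicits.

Definition nilpotents (R : comNzRingType) : set R :=
  [set x | exists n : nat, (0 < n)%N /\ x ^+ n = 0].
Arguments nilpotents R : clear implicits.

Definition ext_zdiv_adj (R : comNzRingType) (x y : R) : Prop :=
  [/\ zero_divisors_star R x, zero_divisors_star R y, x != y &
      exists n m : nat,
        [/\ (0 < n)%N, (0 < m)%N, x ^+ n * y ^+ m = 0, x ^+ n != 0 &
            y ^+ m != 0]].

Lemma ext_zdiv_adj_vertices (R : comNzRingType) (x y : R) :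
  ext_zdiv_adj x y -> zero_divisors_star R x /\ zero_divisors_star R y.
Proof. by case. Qed.

Lemma ext_zdiv_adj_sym (R : comNzRingType) (x y : R) :
  ext_zdiv_adj x y -> ext_zdiv_adj y x.
Proof.
case=> Zx Zy neq_xy [n [m [n_gt0 m_gt0 xy0 xn0 ym0]]].
by split=> //; [rewrite eq_sym | exists m, n; split; rewrite // mulrC].
Qed.

Lemma ext_zdiv_adj_irrefl (R : comNzRingType) (x : R) : ~ ext_zdiv_adj x x.
Proof. by case=> _ _; rewrite eqxx. Qed.

Definition ext_zdiv_graph (R : comNzRingType) : sgraph R :=
  SGraph (@ext_zdiv_adj_vertices R) (@ext_zdiv_adj_sym R)
    (@ext_zdiv_adj_irrefl R).

(* Main.v *)
Require Import Defs.
From HB Require Import structures.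
From mathcomp Require Import all_boot all_order all_algebra.
From mathcomp Require Import boolp classical_sets functions cardinality.
From mathcomp Require Import ring.

Set Implicit Arguments.
Unset Strict Implicit.
Unset Printing Implicit Defensive.

(** Let [a <> 0] with [a ^+ 2 = 0] and let [u] be orthogonal to [a].  A nonzero
multiple of [a] is adjacent to every neighbour of [a] other than itself, so
[R a] is contained in [{0, a, u}].  If [R a] had three elements, then
[u = - a] and the annihilator of [a] would be [{0, a, - a}], so that every
element outside of it would be a unit and [Z(R)] would have three elements.
Hence [R a = {0, a}]: every ring element kills or fixes every square-zero
element.  Then [u] kills [a], and [u] is not nilpotent, since otherwise
[a + u] would be adjacent to both [a] and [u].  A second square-zero [b] must
be fixed by [u], as it would otherwise be adjacent to both [a] and [u]; but
then [u] neither kills nor fixes [a + b].  So [a] is the only nonzero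
square-zero element, and any other nonzero nilpotent, having [a] as its last
nonzero power, would be adjacent to both [a] and [u]. *)

Local Open Scope classical_set_scope.
Local Open Scope card_scope.
Local Open Scope ring_scope.

Import GRing.Theory.

Lemma card_le_seq (T : choiceType) (A : set T) (s : seq T) :
  A `<=` [set` s] -> A #<= `I_(size s).
Proof.
case: s => [|x s] As.
  suff -> : A = set0 by exact: card_ge0.
  by apply/seteqP; split=> // t /As.
apply: card_le_trans (card_image_le (nth x (x :: s)) `I_(size (x :: s))).
apply: subset_card_le => t /As /= ts.
exists (index t (x :: s)); last exact: nth_index.
by rewrite -index_mem in ts.
Qed.

(** Since [2 n >= n + 1] for positive [n], the last nonzero power squares to zero; this turns
    nilpotents into square-zero elements. *)
Lemma last_nonzero_power (R : comNzRingType) (x : R) :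
  x != 0 -> nilpotents R x ->
  exists n : nat,
    [/\ (0 < n)%N, x ^+ n != 0, x ^+ n.+1 = 0 & x ^+ n * x ^+ n = 0].
Proof.
move=> x0 [n [_]]; elim: n => [|n IHn] xn.
  by move: xn; rewrite expr0 => /eqP; rewrite oner_eq0.
have [/IHn//|xn0] := eqVneq (x ^+ n) 0.
case: n xn xn0 {IHn} => [/eqP|n] xn xn0; first by rewrite expr1 (negbTE x0) in xn.
by exists n.+1; split=> //; rewrite [X in _ * X]exprS mulrA -exprSr xn mul0r.
Qed.

(** The last nonzero term among [z], [x * z], [x ^+ 2 * z], ... is killed by [x]. *)
Lemma zero_divisors_expr (R : comNzRingType) (x z : R) (n : nat) :
  z != 0 -> x ^+ n * z = 0 -> zero_divisors R x.
Proof.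
elim: n z => [|n IHn] z z0; first by rewrite expr0 mul1r => /eqP; rewrite (negbTE z0).
rewrite exprSr -mulrA => xz.
have [xz0|xz0] := eqVneq (x * z) 0; first by exists z.
exact: IHn xz0 xz.
Qed.

Lemma ext_zdiv_adjI (R : comNzRingType) (x y : R) (n m : nat) :
  (0 < n)%N -> (0 < m)%N -> x != y ->
  x ^+ n != 0 -> y ^+ m != 0 -> x ^+ n * y ^+ m = 0 -> ext_zdiv_adj x y.
Proof.
move=> n0 m0 xy xn ym xy0; split=> //; last by exists n, m.
- split; first exact: zero_divisors_expr ym xy0.
  by move=> x0; move: xn; rewrite x0 expr0n eqn0Ngt n0 eqxx.
- split; first by apply: zero_divisors_expr xn _; rewrite mulrC; exact: xy0.
  by move=> y0; move: ym; rewrite y0 expr0n eqn0Ngt m0 eqxx.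
Qed.

Lemma orthogonal_no_common (R : comNzRingType) (a u w : R) :
  Defs.orthogonal (ext_zdiv_graph R) a u ->
  ext_zdiv_adj w a -> ext_zdiv_adj w u -> False.
Proof. by move=> [_ nw] wa wu; apply: nw; exists w => //; case: wa. Qed.

Lemma square_zero_orthogonal (R : comNzRingType) (a : R) :
  complemented (ext_zdiv_graph R) -> a != 0 -> a * a = 0 ->
  exists2 u, Defs.orthogonal (ext_zdiv_graph R) a u &
    exists m : nat, [/\ (0 < m)%N, u != a, u ^+ m != 0 & a * u ^+ m = 0].
Proof.
move=> compl a0 aa.
have [|u _ au] := compl a; first by split; [exists a | exact/eqP].
exists u => //; case: (au) => -[_ _ neq_au [n [m [n0 m0 anum an um]]]] _.
exists m; split=> //; first by rewrite eq_sym.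
(* Powers of [a] from the second on vanish, so the edge must use [a] itself. *)
case: n n0 an anum => [//|[|n]] _ /=.
  by rewrite expr1.
by rewrite !exprS mulrA aa mul0r eqxx.
Qed.

Lemma square_zero_mul (R : comNzRingType) (a r : R) :
  `I_4 #<= zero_divisors R -> complemented (ext_zdiv_graph R) ->
  a != 0 -> a * a = 0 -> r * a = 0 \/ r * a = a.
Proof.
move=> card_Z compl a0 aa.
have [u au [m [m0 neq_ua um aum]]] := square_zero_orthogonal compl a0 aa.
have mulaE s : [\/ s * a = 0, s * a = a | s * a = u].
  have [|sa0] := eqVneq (s * a) 0; first by constructor 1.
  have [|saa] := eqVneq (s * a) a; first by constructor 2.
  have [|sau] := eqVneq (s * a) u; first by constructor 3.
  exfalso; apply: (orthogonal_no_common au (w := s * a)).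
    by apply: (@ext_zdiv_adjI _ _ _ 1 1); rewrite // !expr1 -mulrA aa mulr0.
  by apply: (@ext_zdiv_adjI _ _ _ 1 m); rewrite // !expr1 -mulrA aum mulr0.
case: (mulaE r) => [||rau]; [by left | by right | exfalso].
have uE : u = - a.
  have u0 : u != 0.
    by apply: contra_neq um => ->; rewrite expr0n eqn0Ngt m0.
  case: (mulaE (r - 1)); rewrite mulrBl mul1r rau.
  - by move/eqP; rewrite subr_eq0 (negbTE neq_ua).
  - move=> /eqP; rewrite subr_eq => /eqP uaa.
    (* [a + u] is a multiple of [a]; it is neither [a] nor [u] as both are nonzero, so it is [0]. *)
    case: (mulaE (1 + r)); rewrite mulrDl mul1r rau.
    + by rewrite addrC => /eqP; rewrite addr_eq0 => /eqP.
    + by rewrite -[RHS]addr0 => /addrI /eqP; rewrite (negbTE u0).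
    + by rewrite -[RHS]add0r => /addIr /eqP; rewrite (negbTE a0).
  - by rewrite -[RHS]addr0 => /addrI /eqP; rewrite oppr_eq0 (negbTE a0).
have annE w : w * a = 0 -> w \in [:: 0; a; - a].
  move=> wa; rewrite !inE; apply/negPn; rewrite !negb_or.
  apply/negP => /and3P[w0 neq_wa neq_wNa].
  apply: (orthogonal_no_common au (w := w)).
    by apply: (@ext_zdiv_adjI _ _ _ 1 1).
  rewrite uE; apply: (@ext_zdiv_adjI _ _ _ 1 1); rewrite // ?expr1 ?oppr_eq0 //.
  by rewrite ?expr1 mulrN wa oppr0.
have ann_sq w : w * a = 0 -> w * w = 0.
  by move=> /annE; rewrite !inE => /or3P[] /eqP ->; rewrite ?mulr0 ?mulrNN ?aa.
have ZE : zero_divisors R `<=` [set` [:: 0; a; - a]].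
  move=> y [z z0 yz] /=; apply: annE.
  case: (mulaE y) => // ya; exfalso; move/eqP: z0; apply.
  (* If [y] sends [a] to [a] or [- a], then [y - 1] or [y + 1] squares to zero, so [y] is a unit
     with inverse [2 - y] or [- (y + 2)], and [y * z = 0] forces [z = 0]. *)
  - have /ann_sq yy : (y - 1) * a = 0 by rewrite mulrBl mul1r ya subrr.
    have -> : z = (y - 1) * (y - 1) * z - (y * z) * (y - 2) by ring.
    by rewrite yy yz !mul0r subrr.
  - have /ann_sq yy : (y + 1) * a = 0 by rewrite mulrDl mul1r ya uE addNr.
    have -> : z = (y + 1) * (y + 1) * z - (y * z) * (y + 2) by ring.
    by rewrite yy yz !mul0r subrr.
by have := card_le_trans card_Z (card_le_seq ZE); rewrite card_le_II.
Qed.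

Lemma nilpotent_unique (R : comNzRingType) (a b : R) :
  `I_4 #<= zero_divisors R -> complemented (ext_zdiv_graph R) ->
  a != 0 -> a * a = 0 -> b != 0 -> nilpotents R b -> b = a.
Proof.
move=> card_Z compl a0 aa b0 nil_b.
have [u au [m [m0 neq_ua um aum]]] := square_zero_orthogonal compl a0 aa.
have mulE (c r : R) : c != 0 -> c * c = 0 -> r * c = 0 \/ r * c = c.
  exact: square_zero_mul.
(* Hence an element with some power killing [c != 0] cannot fix [c], so it kills [c]. *)
have fix_pow (c r : R) k : r * c = c -> r ^+ k * c = c.
  by move=> rc; elim: k => [|k IHk]; rewrite ?expr0 ?mul1r // exprS -mulrA IHk.
have ua : u * a = 0.
  have [//|/fix_pow ua] := mulE a u a0 aa.
  by move: a0; rewrite -(ua m) mulrC aum eqxx.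
have aNa : - a = a.
  have [|] := mulE a (-1) a0 aa; rewrite mulN1r //.
  by move/eqP; rewrite oppr_eq0 (negbTE a0).
have u0 : u != 0 by apply: contra_neq um => ->; rewrite expr0n eqn0Ngt m0.
have u_nonnil : ~ nilpotents R u.
  move=> /(last_nonzero_power u0)[k [k0 uk uk1 _]].
  have au0 : a + u != 0 by rewrite addrC addr_eq0 aNa.
  have aua : a + u != a by rewrite -subr_eq0 addrC addKr.
  have auu : a + u != u by rewrite -subr_eq0 addrK.
  (* Both [a * a] and [u * a] vanish, so [a] survives only in the first power; [k = 1] is therefore
     treated apart below. *)
  have aukE j : (a + u) ^+ j.+2 = u ^+ j.+2.
    elim: j => [|j IHj]; last first.
      by rewrite exprSr IHj mulrDr -exprSr exprSr -mulrA ua mulr0 add0r.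
    have -> : (a + u) ^+ 2 = a * a + 2 * (u * a) + u ^+ 2 by ring.
    by rewrite aa ua mulr0 !add0r.
  apply: (orthogonal_no_common au (w := a + u)).
    apply: (@ext_zdiv_adjI _ _ _ 1 1); rewrite // ?expr1 //.
    by rewrite mulrDl aa ua addr0.
  case: k k0 uk uk1 => [//|[|k]] _ uk uk1.
    apply: (@ext_zdiv_adjI _ _ _ 1 1); rewrite // ?expr1 //.
    by rewrite mulrDl -expr2 uk1 mulrC ua addr0.
  apply: (@ext_zdiv_adjI _ _ _ k.+2 1); rewrite // ?aukE // ?expr1 //.
  by rewrite -exprSr.
have sq0_unique c : c != 0 -> c * c = 0 -> c = a.
  move=> c0 cc; apply/eqP/negPn/negP => neq_ca.
  have nil_c : nilpotents R c by exists 2; rewrite expr2.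
  have neq_cu : c != u by apply/eqP => cu; apply: u_nonnil; rewrite -cu.
  have ca : c * a = 0.
    have [//|/fix_pow ca] := mulE a c a0 aa.
    by move: a0; rewrite -(ca 2) expr2 cc mul0r eqxx.
  have [uc|uc] := mulE c u c0 cc.
    apply: (orthogonal_no_common au (w := c)).
      exact: (@ext_zdiv_adjI _ _ _ 1 1).
    by apply: (@ext_zdiv_adjI _ _ _ 1 1); rewrite // !expr1 mulrC.
  have ac0 : a + c != 0 by rewrite addrC addr_eq0 aNa.
  have acac : (a + c) * (a + c) = 0.
    have -> : (a + c) * (a + c) = a * a + 2 * (c * a) + c * c by ring.
    by rewrite aa ca cc mulr0 !addr0.
  have [] := mulE (a + c) u ac0 acac; rewrite mulrDr ua uc add0r => /eqP.
    by rewrite (negbTE c0).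
  by rewrite eq_sym -subr_eq0 addrK (negbTE a0).
have [k [k0 bk bk1 bkbk]] := last_nonzero_power b0 nil_b.
have bkE : b ^+ k = a by exact: sq0_unique.
apply/eqP/negPn/negP => neq_ba.
have neq_bu : b != u by apply/eqP => bu; apply: u_nonnil; rewrite -bu.
(* The edges come from [b * a = b ^+ k.+1 = 0] and [b ^+ k * u = a * u = 0]. *)
apply: (orthogonal_no_common au (w := b)).
  by apply: (@ext_zdiv_adjI _ _ _ 1 1); rewrite // !expr1 -bkE -exprS.
by apply: (@ext_zdiv_adjI _ _ _ k 1); rewrite // expr1 bkE mulrC.
Qed.

Theorem theorem2p4 (R : comNzRingType)
  (card_Z : `I_4 #<= zero_divisors R)
  (compl : complemented (ext_zdiv_graph R)) :
  nilpotents R #<= `I_2.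
Proof.
suff [a nilE] : exists a : R, nilpotents R `<=` [set` [:: 0; a]].
  exact: card_le_seq nilE.
have [[b [nil_b b0]]|none] := pselect (exists b : R, nilpotents R b /\ b != 0).
  have [k [k0 bk _ bkbk]] := last_nonzero_power b0 nil_b.
  exists (b ^+ k) => c nil_c /=; rewrite !inE.
  have [//|c0] := eqVneq c 0; apply/eqP.
  exact: nilpotent_unique.
(* Without nonzero nilpotents, [0] merely fills the second entry of the list. *)
exists 0 => c nil_c /=; rewrite !inE orbb.
by apply/negPn/negP => c0; apply: none; exists c.
Qed.
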